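(* Let $S$ be a semigroup and let $\mathcal{F}=\langle F_i\rangle_{i\in I}$ be a net in $\mathcal{P}_f(S)$. Suppose that at least one of the following two conditions holds: (1) there is some $b\in\mathbb{N}$ such that $S$ is $b$-weakly right cancellative; (2) there is some $b\in\mathbb{N}$ such that $S$ is $b$-weakly left cancellative, and $\mathcal{F}$ satisfies condition $( * )$. Then there exists a $D$-set with respect to $\mathcal{F}$ in $S$.
   Context: Semigroups are nonempty and discrete; $\mathbb{N}=\{1,2,\dots\}$; $\mathcal{P}_f(X)$ is the set of finite nonempty subsets of $X$. $\beta S$ is the space of ultrafilters on $S$ (Stone–Čech compactification), with basic open sets $\overline{A}=\{p\in\beta S: A\in p\}$ for $A\subseteq S$, and semigroup operation $pq=\{A\subseteq S:\{s\in S: s^{-1}A\in q\}\in p\}$, where $s^{-1}A=\{t\in S: st\in A\}$. For a net $\mathcal{F}=\langle F_i\rangle_{i\in I}$ in $\mathcal{P}_f(S)$ ($I$ a directed set) and $A\subseteq S$, the upper Banach density of $A$ with respect to $\mathcal{F}$ is $$d_{\mathcal{F}}^*(A)=\sup\{\alpha: (\forall i_0\in I)(\exists i\geq i_0)(\exists s\in S\cup\{1\})(|A\cap(F_i\cdot s)|\geq\alpha|F_i|)\},$$ where $F_i\cdot 1$ means $F_i$ ($S$ is not assumed to have an identity). Put $D_{\mathcal{F}}^*=\{p\in\beta S:(\forall A\in p)(d_{\mathcal{F}}^*(A)>0)\}$. A subset $A\subseteq S$ is a $D$-set with respect to $\mathcal{F}$ if $A\in p$ for some idempotent $p$ ($pp=p$)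 of $\beta S$ with $p\in D_{\mathcal{F}}^*$. $S$ is $b$-weakly left cancellative (respectively $b$-weakly right cancellative) if for all $t,u\in S$, $|\{s\in S: ts=u\}|\leq b$ (respectively $|\{s\in S: st=u\}|\leq b$). Condition $( * )$ for $\mathcal{F}$: $(\forall\epsilon>0)(\forall t\in S)(\exists c\in\mathbb{N})(\exists l\in I)(\forall i_0\geq l)(\exists i\geq i_0)(\exists s\in S\cup\{1\})\big(|(t\cdot F_{i_0})\setminus(F_i\cdot s)|<\epsilon\cdot|F_{i_0}|\text{ and }|F_i|\leq c\cdot|F_{i_0}|\big)$. *)

(* Defs.v *)
From HB Require Import structures.
From mathcomp Require Import all_boot all_order all_algebra.
From mathcomp Require Import finmap.
From mathcomp Require Import all_classical all_reals.

Set Implicit Arguments.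
Unset Strict Implicit.
Unset Printing Implicit Defensive.

Import Order.TTheory GRing.Theory Num.Theory.

Local Open Scope classical_set_scope.
Local Open Scope card_scope.
Local Open Scope ring_scope.

Section StoneCech.
Context {S : semigroupType}.

(* Points of beta S are the [p : set_system S] with [UltraFilter p]. *)

Definition ldiv (s : S) (A : set S) : set S := [set t | A (s * t)%g].

Definition beta_mul (p q : set_system S) : set_system S :=
  [set A | p [set s | q (ldiv s A)]].

Lemma beta_mul_ultra (p q : set_system S) :
  UltraFilter p -> UltraFilter q -> UltraFilter (beta_mul p q).
Proof.
move=> pU qU.
have PF : ProperFilter (beta_mul p q).
  split; first by rewrite /beta_mul /= => p0; apply: (@filter_not_empty _ p);
    apply: filterS p0 => s /= q0; exact: (@filter_not_empty _ q).
  split=> [|A B|A B AB]; rewrite /beta_mul /=.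
  - by apply: filterS filterT => s _; exact: filterT.
  - by move=> pA pB; apply: filterS2 pA pB => s; exact: filterI.
  - by apply: filterS => s; apply: filterS => t; exact: AB.
split=> // G GF pqG; apply/seteqP; split=> // A GA.
have [//|pN] := in_ultra_setVsetC [set s | q (ldiv s A)] pU.
exfalso; apply: (@filter_not_empty _ G).
suff GN : G (~` A) by rewrite -(setICr A); exact: filterI.
apply: pqG; rewrite /beta_mul /=; apply: filterS pN => s /= NqA.
by case: (in_ultra_setVsetC (ldiv s A) qU).
Qed.

End StoneCech.

Section Cancellation.
Variable S : semigroupType.

Definition weakly_left_cancellative (b : nat) : Prop :=
  forall t u : S, [set s : S | (t * s)%g = u] #<= `I_b.

Definition weakly_right_cancellative (b : nat) : Prop :=
  forall t u : S, [set s : S | (s * t)%g = u] #<= `I_b.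

End Cancellation.

Definition directed (d : Order.disp_t) (I : preorderType d) : Prop :=
  (exists i : I, True) /\
  forall i j : I, exists k : I, (i <= k)%O /\ (j <= k)%O.

Section Density.
Context {S : semigroupType}.

Definition ltranslate (t : S) (F : {fset S}) : {fset S} :=
  [fset (t * x)%g | x in F]%fset.

(* [option S] stands for S with an adjoined right-acting 1, namely [None]. *)
Definition rtranslate (F : {fset S}) (s : option S) : {fset S} :=
  if s is Some s' then [fset (x * s')%g | x in F]%fset else F.

Definition cardI (A : set S) (F : {fset S}) : nat :=
  #|` [fset x in F | x \in A]%fset|.

Variables (R : realType) (d : Order.disp_t) (I : preorderType d).
Variable F : I -> {fset S}.

Definition upper_density (A : set S) : R :=
  sup [set a : R | forall i0 : I, exists i : I, (i0 <= i)%O /\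
    exists s : option S,
      a * #|` F i|%:R <= (cardI A (rtranslate (F i) s))%:R].

Definition Dstar (p : set_system S) : Prop :=
  UltraFilter p /\ forall A : set S, p A -> 0 < upper_density A.

Definition D_set (A : set S) : Prop :=
  exists p : set_system S, [/\ Dstar p, beta_mul p p = p & p A].

Definition condition_star : Prop :=
  forall eps : R, 0 < eps -> forall t : S,
  exists c : nat, (0 < c)%N /\ exists l : I,
  forall i0 : I, (l <= i0)%O -> exists i : I, (i0 <= i)%O /\
  exists s : option S,
    #|` (ltranslate t (F i0) `\` rtranslate (F i) s)%fset|%:R
      < eps * #|` F i0|%:R :> R
    /\ (#|` F i| <= c * #|` F i0|)%N.

End Density.

(* Main.v *)
Require Import Defs.
From HB Require Import structures.
From mathcomp Require Import all_boot all_order all_algebra.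
From mathcomp Require Import finmap.
From mathcomp Require Import all_classical all_reals.
From mathcomp Require Import ring lra.

(* D* is the closed set of the ultrafilters avoiding every set of density 0; it
   is nonempty because density-0 sets form a proper ideal. Right translation by
   an element of a b-weakly right cancellative semigroup shrinks finite sets by
   a factor at most b and maps translates F_i s to translates, so D* is a right
   ideal of beta S. In the left cancellative case the same holds for left
   translation, except that t F_i s is no longer a translate; condition ( * )
   compensates by nearly covering it with a translate of some F_j of comparable
   size, and D* is a left ideal. Either way D* is a closed subsemigroup, hence
   contains an idempotent by the Ellis-Numakura theorem. *)

Import Order.TTheory GRing.Theory Num.Theory.

Local Open Scope classical_set_scope.
Local Open Scope card_scope.

(** * Closed subsemigroups of beta S, encoded by filters, and their idempotents *)

Section Idempotents.
Context {S : semigroupType}.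
Implicit Types p q r G H : set_system S.

Lemma beta_mulA p q r :
  beta_mul (beta_mul p q) r = beta_mul p (beta_mul q r).
Proof.
apply/funext => A; rewrite /beta_mul /=; congr (p _); apply/funext => s /=.
congr (q _); apply/funext => t /=; congr (r _).
by apply/funext => u; rewrite /ldiv /= mulgA.
Qed.

Lemma beta_mul_proper G q :
  ProperFilter G -> ProperFilter q -> ProperFilter (beta_mul G q).
Proof.
move=> GF qF; split.
  move=> G0; have [s /=] := @filter_ex _ G _ _ G0; exact: filter_not_empty.
split=> [|A B|A B AB]; rewrite /beta_mul /=.
- by apply: filterS filterT => s _; exact: filterT.
- by move=> GA GB; apply: filterS2 GA GB => s; exact: filterI.
- by apply: filterS => s; apply: filterS => t; exact: AB.
Qed.

(* A filter [G] encodes the closed set of the ultrafilters containing it; every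
   closed subset of beta S is of this form. *)
Definition closed_subsemigroup G : Prop :=
  forall p q, UltraFilter p -> UltraFilter q -> G `<=` p -> G `<=` q ->
  G `<=` beta_mul p q.

(* The closed set of the [p] containing [G] such that [beta_mul p q = r]. *)
Definition mul_fiber G q r : set_system S :=
  filter_from [set BA : set S * set S | G BA.1 /\ r BA.2]
    (fun BA => BA.1 `&` [set s | q (ldiv s BA.2)]).

(** If a base set [B] meets no [s] with [ldiv s A] in [q], then every [s] in [B] has [ldiv s (~]
    A)[in]q[; so]~[A] lies in [beta_mul G q], hence in [r] along with [A]. *)
Lemma mul_fiber_proper G q r : ProperFilter G -> UltraFilter q ->
  ProperFilter r -> beta_mul G q `<=` r -> ProperFilter (mul_fiber G q r).
Proof.
move=> GF qU rF Gqr; apply: filter_from_proper.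
  apply: filter_from_filter.
    by exists (setT, setT); split; exact: filterT.
  move=> [B A] [B' A'] [/= GB rA] [/= GB' rA'].
  exists (B `&` B', A `&` A'); first by split; exact: filterI.
  move=> s /= [[Bs B's] qs].
  by split; (split=> //; apply: filterS qs => t []).
move=> [B A] [/= GB rA]; apply: contrapT => BA0.
apply: (@filter_not_empty _ r); rewrite -(setICr A); apply: filterI => //.
apply: Gqr; rewrite /beta_mul /=; apply: filterS GB => s Bs.
have [qsA|//] := in_ultra_setVsetC (ldiv s A) qU.
by exfalso; apply: BA0; exists s.
Qed.

Lemma sub_mul_fiber G q r : Filter r -> G `<=` mul_fiber G q r.
Proof.
move=> rF B GB; exists (B, setT); first by split=> //; exact: filterT.
by move=> s [].
Qed.

(** The product contains [r], and ultrafilters are maximal among proper filters. *)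
Lemma mul_fiberE G q r p : Filter G -> UltraFilter r -> UltraFilter p ->
  UltraFilter q -> mul_fiber G q r `<=` p -> beta_mul p q = r.
Proof.
move=> GF rU pU qU fp.
apply: max_filter; first exact: beta_mul_proper.
move=> A rA; apply: fp.
by exists (setT, A) => [|s []//]; split=> //; exact: filterT.
Qed.

Lemma mul_fiber_sub G q r p : Filter p -> G `<=` p -> beta_mul p q = r ->
  mul_fiber G q r `<=` p.
Proof.
move=> pF Gp <- C [[B A] [/= GB pqA] sub].
exact: (filterS sub (@filterI _ p _ _ _ (Gp _ GB) pqA)).
Qed.

(** Compactness: [beta_mul G q] encodes exactly the image of the closed set of [G] under right
    multiplication by [q], so each of its points is attained. *)
Lemma mul_lift G q r : ProperFilter G -> UltraFilter q -> UltraFilter r ->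
  beta_mul G q `<=` r ->
  exists p, [/\ UltraFilter p, G `<=` p & beta_mul p q = r].
Proof.
move=> GF qU rU Gqr.
have fF : ProperFilter (mul_fiber G q r) by exact: mul_fiber_proper.
have [p [pU fp]] := ultraFilterLemma fF.
exists p; split => //; last exact: mul_fiberE fp.
by apply: subset_trans fp; exact: sub_mul_fiber.
Qed.

(** Larger filters encode smaller closed sets, so a minimal subsemigroup is a maximal filter; the
    union of a chain encodes the intersection of its closed sets. *)
Lemma exists_minimal_closed_subsemigroup G :
  ProperFilter G -> closed_subsemigroup G ->
  exists M, [/\ ProperFilter M, G `<=` M, closed_subsemigroup M &
    forall N, ProperFilter N -> closed_subsemigroup N -> M `<=` N -> N = M].
Proof.
move=> GF Gcs.
pose good M := [/\ ProperFilter M, G `<=` M & closed_subsemigroup M].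
(* [set0] only serves as the union of the empty chain. *)
have [|M [+ maxM]] := @Zorn_bigcup _ [set M | M = set0 \/ good M].
  move=> C Cgood Ctot.
  have [[M0 CM0 gM0]|noC] := pselect (exists2 M, C M & good M); last first.
    left; apply/seteqP; split=> // A [X CX XA].
    have [X0|gX] := Cgood _ CX; first by rewrite X0 in XA.
    by case: noC; exists X.
  have goodC X A : C X -> X A -> good X.
    by move=> CX XA; have [X0|//] := Cgood _ CX; rewrite X0 in XA.
  have [M0F GM0 _] := gM0.
  right; split.
  - split; first by move=> [X CX X0]; have [XF _ _] := goodC _ _ CX X0;
      exact: (@filter_not_empty _ X).
    split=> [|A B|A B AB].
    + by exists M0 => //; exact: filterT.
    + move=> [X CX XA] [Y CY YB].
      have [XF _ _] := goodC _ _ CX XA; have [YF _ _] := goodC _ _ CY YB.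
      have [XY|YX] := Ctot _ _ CX CY.
        by exists Y => //; apply: filterI => //; exact: XY.
      by exists X => //; apply: filterI => //; exact: YX.
    + move=> [X CX XA]; have [XF _ _] := goodC _ _ CX XA.
      by exists X => //; apply: filterS XA.
  - by move=> A GA; exists M0 => //; exact: GM0.
  - move=> p q pU qU Cp Cq A [X CX XA]; have [_ _ Xcs] := goodC _ _ CX XA.
    by apply: (Xcs p q) => // B XB; [apply: Cp|apply: Cq]; exists X.
case=> [M0|[MF GM Mcs]].
  exfalso; apply: (maxM G); last by right; split.
  rewrite M0; split => // /(_ setT); apply; exact: filterT.
exists M; split => // N NF Ncs MN; apply: contrapT => NM.
apply: (maxM N); last by right; split => //; exact: subset_trans MN.
by split=> // NsubM; apply: NM; apply/seteqP.
Qed.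

(* Ellis-Numakura: for [q] in a minimal closed subsemigroup [M], both [M q] and
   the set of the [p] in [M] with [p q = q] are closed subsemigroups of [M]. *)
Lemma closed_subsemigroup_idempotent G :
  ProperFilter G -> closed_subsemigroup G ->
  exists p, [/\ UltraFilter p, G `<=` p & beta_mul p p = p].
Proof.
move=> GF Gcs.
have [M [MF GM Mcs Mmin]] := exists_minimal_closed_subsemigroup _ GF Gcs.
have [q [qU Mq]] := ultraFilterLemma MF.
(* M q is contained in M: otherwise some ultrafilter [p] above [M] avoids the set of [s] with
   [ldiv s A] in [q], although [beta_mul p q] contains [M]. *)
have MMq : M `<=` beta_mul M q.
  move=> A MA; apply: contrapT => NA.
  have fF : ProperFilter
      (filter_from M (fun B => B `&` ~` [set s | q (ldiv s A)])).
    apply: filter_from_proper.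
      apply: filter_from_filter; first by exists setT; exact: filterT.
      move=> B C MB MC; exists (B `&` C); first exact: filterI.
      by move=> s [[? ?] ?].
    move=> B MB; apply: contrapT => B0; apply: NA; apply: filterS MB => s Bs.
    by apply: contrapT => Nq; apply: B0; exists s.
  have [p [pU fp]] := ultraFilterLemma fF.
  have Mp : M `<=` p by move=> B MB; apply: fp; exists B => // s [].
  have pA : p [set s | q (ldiv s A)] by exact: Mcs.
  have pNA : p (~` [set s | q (ldiv s A)]).
    by apply: fp; exists setT => [|s []//]; exact: filterT.
  by apply: (@filter_not_empty _ p); rewrite -(setICr [set s | q (ldiv s A)]);
  exact: filterI.
have Mq_cs : closed_subsemigroup (beta_mul M q).
  move=> r1 r2 r1U r2U Mr1 Mr2.
  have [p1 [p1U Mp1 <-]] := mul_lift _ _ _ MF qU r1U Mr1.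
  have [p2 [p2U Mp2 <-]] := mul_lift _ _ _ MF qU r2U Mr2.
  have p1qU := beta_mul_ultra p1U qU.
  (* p1 q p2 lies in M, so (p1 q)(p2 q) = (p1 q p2) q lies in M q. *)
  have Mp : M `<=` beta_mul (beta_mul p1 q) p2 by apply: (Mcs) => //; exact: Mcs.
  by rewrite -beta_mulA => A; exact: Mp.
have Mq_eq : beta_mul M q = M.
  by apply: Mmin => //; exact: beta_mul_proper.
(* As [q] lies in M = M q, some p in M satisfies p q = q, so the fiber is nonempty; it is closed
   under products because p1 p2 q = p1 q = q. *)
have Mqq : beta_mul M q `<=` q by rewrite Mq_eq.
have stab : mul_fiber M q q = M.
  apply: Mmin; [exact: mul_fiber_proper| |exact: sub_mul_fiber].
  move=> p1 p2 p1U p2U f1 f2.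
  have e1 := mul_fiberE _ _ _ _ _ qU p1U qU f1.
  have e2 := mul_fiberE _ _ _ _ _ qU p2U qU f2.
  have p12U := beta_mul_ultra p1U p2U.
  apply: mul_fiber_sub; last by rewrite beta_mulA e2 e1.
  have Mf : M `<=` mul_fiber M q q by exact: sub_mul_fiber.
  by apply: Mcs => //; exact: (subset_trans Mf).
exists q; split=> //; first exact: subset_trans Mq.
by apply: (mul_fiberE M) => //; rewrite stab.
Qed.

End Idempotents.

Local Open Scope ring_scope.
Local Open Scope fset_scope.

(** * Counting in finite sets and their translates *)

Section Counting.

Lemma leq_card_bounded_fibers (T T' : choiceType) (f : T -> T') (n : nat)
    (X : {fset T}) : (forall u, [set s | f s = u] #<= `I_n) ->
  (#|` X| <= n * #|` f @` X|)%N.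
Proof.
move=> fibn; rewrite card_fset_sum1 (partition_big_imfset _ f) /=.
have -> : (n * #|` f @` X| = \sum_(j <- f @` X) n)%N.
  by rewrite big_const_seq count_predT iter_addn_0.
apply: leq_sum => j _.
have fin : finite_set [set s | f s = j] by apply/finite_set_leP; exists n.
have -> : (\sum_(i <- X | f i == j) 1 = #|` [fset i in X | f i == j]|)%N.
  by rewrite card_fset_sum1 big_fset /=.
apply: leq_trans (geq_card_fset_set (fibn j)).
apply/fsubset_leq_card/fsubsetP => i; rewrite !inE => /andP[_ /eqP fi].
by rewrite in_fset_set // inE.
Qed.

Context {S : semigroupType}.
Implicit Types (A B : set S) (X Y : {fset S}).

Lemma leq_cardI A X : (cardI A X <= #|` X|)%N.
Proof. by apply/fsubset_leq_card/fsubsetP => x; rewrite !inE => /andP[]. Qed.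

Lemma cardIT X : cardI setT X = #|` X|.
Proof. by congr #|` _|; apply/fsetP => x; rewrite !inE in_setT andbT. Qed.

Lemma cardI0 X : cardI set0 X = 0%N.
Proof.
by apply/eqP; rewrite cardfs_eq0; apply/eqP/fsetP => x; rewrite !inE in_set0 andbF.
Qed.

Lemma cardIS A B X : (A `<=` B)%classic -> (cardI A X <= cardI B X)%N.
Proof.
move=> AB; apply/fsubset_leq_card/fsubsetP => x; rewrite !inE => /andP[-> /=].
by rewrite !in_setE; exact: AB.
Qed.

Lemma cardIU A B X : (cardI (A `|` B)%classic X <= cardI A X + cardI B X)%N.
Proof.
rewrite /cardI -cardfsUI; apply: leq_trans (leq_addr _ _).
apply/fsubset_leq_card/fsubsetP => x.
by rewrite !inE => /andP[-> /=]; rewrite in_setU.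
Qed.

Lemma cardI_fsetD A X Y : (cardI A X <= cardI A Y + #|` X `\` Y|)%N.
Proof.
rewrite /cardI -cardfsUI; apply: leq_trans (leq_addr _ _).
apply/fsubset_leq_card/fsubsetP => x; rewrite !inE => /andP[-> ->].
by rewrite !andbT orbN.
Qed.

(** Cancellation enters here: [f] will be right or left multiplication by a fixed element. *)
Lemma cardI_image A B X (f : S -> S) (b : nat) :
  (forall u, [set s | f s = u] #<= `I_b) ->
  (forall x, x \in X -> B x -> A (f x)) ->
  (cardI B X <= b * cardI A (f @` X))%N.
Proof.
move=> fibb BA; apply: leq_trans (leq_card_bounded_fibers _ _ _ _ _ fibb) _.
rewrite leq_mul2l; apply/orP; right.
apply/fsubset_leq_card/fsubsetP => y /imfsetP[x /=].
rewrite !inE => /andP[xX /set_mem Bx] ->; apply/andP; split.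
  exact: in_imfset.
by rewrite in_setE; exact: BA.
Qed.

Lemma card_rtranslate X s : (#|` rtranslate X s| <= #|` X|)%N.
Proof. by case: s => [s|//]; exact: leq_imfset_card. Qed.

Lemma rtranslate_rtranslate X s s' :
  exists s'', rtranslate (rtranslate X s) s' = rtranslate X s''.
Proof.
case: s' => [s'|]; last by exists s.
case: s => [s|]; last by exists (Some s').
exists (Some (s * s')%g) => /=; rewrite -imfset_comp.
by apply: eq_imfset => // x /=; rewrite mulgA.
Qed.

Lemma ltranslate_rtranslate t X s :
  ltranslate t (rtranslate X s) = rtranslate (ltranslate t X) s.
Proof.
case: s => [s|//]; rewrite /ltranslate /= -!imfset_comp.
by apply: eq_imfset => // x /=; rewrite mulgA.
Qed.

(** A point x s outside Y s has x outside Y. *)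
Lemma card_rtranslateD X Y s :
  (#|` rtranslate X s `\` rtranslate Y s| <= #|` X `\` Y|)%N.
Proof.
case: s => [s|//] /=.
apply: (@leq_trans #|` [fset (x * s)%g | x in X `\` Y]|); last first.
  exact: leq_imfset_card.
apply/fsubset_leq_card/fsubsetP => y; rewrite !inE => /andP[yY /imfsetP[x /= xX yE]].
apply/imfsetP; exists x => //=; rewrite inE xX andbT.
by apply: contra yY => xY; rewrite yE; exact: in_imfset.
Qed.

End Counting.

(** * Positive density, the filter of [Dstar], and its ideal properties *)

Section PositiveDensity.
Variables (R : realType) (S : semigroupType).
Variables (d : Order.disp_t) (I : preorderType d) (F : I -> {fset S}).
Hypothesis Idir : directed I.
Hypothesis Fne : forall i : I, F i <> fset0.

Local Notation density := (upper_density R F).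

Lemma card_F_gt0 i : 0 < #|` F i|%:R :> R.
Proof. by rewrite ltr0n cardfs_gt0; apply/eqP. Qed.

(** The set under the supremum contains 0 and is bounded by 1, since a translate of [F i] has at
    most as many points as the nonempty set [F i]. *)
Lemma upper_density_gt0P (A : set S) : 0 < density A <->
  exists2 a : R, 0 < a & forall i0, exists i, (i0 <= i)%O /\
    exists s, a * #|` F i|%:R <= (cardI A (rtranslate (F i) s))%:R.
Proof.
split=> [/sup_gt[|a aA a0]|[a a0 aA]]; last 2 first.
- by exists a.
- apply: (lt_le_trans a0); apply: ub_le_sup => //; exists 1 => c cA.
  have [[i0 _] _] := Idir; have [i [_ [s cs]]] := cA i0.
  rewrite -(ler_pM2r (card_F_gt0 i)) mul1r (le_trans cs) // ler_nat.
  exact: leq_trans (leq_cardI _ _) (card_rtranslate _ _).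
by exists 0 => i0; exists i0; split => //; exists None; rewrite mul0r ler0n.
Qed.

Lemma upper_density_gt0S (A B : set S) :
  (A `<=` B)%classic -> 0 < density A -> 0 < density B.
Proof.
move=> AB /upper_density_gt0P[a a0 aA]; apply/upper_density_gt0P; exists a => // i0.
have [i [i0i [s le]]] := aA i0; exists i; split => //; exists s.
by rewrite (le_trans le) // ler_nat cardIS.
Qed.

Lemma upper_densityT_gt0 : 0 < density setT.
Proof.
apply/upper_density_gt0P; exists 1 => // i; exists i; split => //.
by exists None; rewrite mul1r cardIT.
Qed.

Lemma upper_density0_gt0 : ~ 0 < density set0.
Proof.
move=> /upper_density_gt0P[a a0 aA]; have [[i0 _] _] := Idir.
have [i [_ [s]]] := aA i0; rewrite cardI0 leNgt mulr_gt0 //; exact: card_F_gt0.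
Qed.

(** If neither density is positive, both sets eventually stay below the ratio [a / 2] on all
    translates; past a common index the union stays below [a]. *)
Lemma upper_density_gt0U (A B : set S) : 0 < density (A `|` B)%classic ->
  0 < density A \/ 0 < density B.
Proof.
move=> /upper_density_gt0P[a a0 aAB].
have a20 : 0 < a / 2 by rewrite divr_gt0.
have small (C : set S) : ~ 0 < density C -> exists i0, forall i, (i0 <= i)%O ->
    forall s, (cardI C (rtranslate (F i) s))%:R < a / 2 * #|` F i|%:R.
  move=> NC; apply: contrapT => Nex; apply: NC; apply/upper_density_gt0P.
  exists (a / 2) => // i0; apply: contrapT => Ni; apply: Nex; exists i0 => i ii s.
  rewrite ltNge; apply/negP => le; apply: Ni; exists i; split => //.
  by exists s.
apply: contrapT => /not_orP[/small[i1 A1] /small[i2 B2]].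
have [k [i1k i2k]] := Idir.2 i1 i2; have [i [ki [s le]]] := aAB k.
have := cardIU A B (rtranslate (F i) s); rewrite -(ler_nat R) natrD => le'.
have := A1 i (le_trans i1k ki) s; have := B2 i (le_trans i2k ki) s.
by move: le le'; lra.
Qed.

Definition conull : set_system S := [set A | ~ 0 < density (~` A)%classic].

Lemma conull_proper : ProperFilter conull.
Proof.
split; first by rewrite /conull /= setC0; apply; exact: upper_densityT_gt0.
split=> [|A B|A B AB]; rewrite /conull /=.
- by rewrite setCT; exact: upper_density0_gt0.
- by rewrite setCI => NA NB /upper_density_gt0U[].
- by move=> NA NB; apply/NA/upper_density_gt0S/NB; exact: subsetC.
Qed.

Lemma DstarE p : UltraFilter p -> Dstar R F p <-> (conull `<=` p)%classic.
Proof.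
move=> pU; split=> [[_ pD] A nA|cp].
  by have [//|/pD] := in_ultra_setVsetC A pU.
split=> // A pA; apply: contrapT => NA.
apply: (@filter_not_empty _ p); rewrite -(setICr A); apply: filterI => //.
by apply: cp; rewrite /conull /= setCK.
Qed.

Lemma Dstar_mulr (b : nat) p q : (0 < b)%N -> weakly_right_cancellative S b ->
  UltraFilter q -> Dstar R F p -> Dstar R F (beta_mul p q).
Proof.
move=> b0 rc qU [pU pD]; split=> [|A pqA]; first exact: beta_mul_ultra.
have /upper_density_gt0P[a a0 aB] := pD _ pqA.
have bR0 : 0 < b%:R :> R by rewrite ltr0n.
apply/upper_density_gt0P; exists (a / b%:R); first exact: divr_gt0.
move=> i0; have [i [i0i [s le]]] := aB i0; exists i; split=> //.
set X := rtranslate (F i) s in le.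
set B := [set s | q (ldiv s A)]%classic in le.
(* One [t] serves all the finitely many [x]: a finite intersection of members of [q] is nonempty. *)
have [t tA] : exists t, forall x, x \in X -> B x -> A (x * t)%g.
  have qX : q (\bigcap_(x in [set` [fset x in X | x \in B]]) ldiv x A)%classic.
    by apply: filter_bigI => x; rewrite !inE => /andP[_ /set_mem].
  have [t tX] := @filter_ex _ q _ _ qX.
  by exists t => x xX Bx; apply: tX; rewrite /= !inE xX /=; exact/mem_set.
have [s' s'E] := rtranslate_rtranslate (F i) s (Some t).
exists s'; rewrite -s'E mulrAC ler_pdivrMr // (le_trans le) // -natrM ler_nat.
by rewrite mulnC; apply: cardI_image => // u; exact: rc.
Qed.

Lemma Dstar_mull (b : nat) p q : (0 < b)%N -> weakly_left_cancellative S b ->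
  condition_star R F ->
  UltraFilter p -> Dstar R F q -> Dstar R F (beta_mul p q).
Proof.
move=> b0 lc star pU [qU qD]; split=> [|A pqA]; first exact: beta_mul_ultra.
have [t qtA] := @filter_ex _ p _ _ pqA.
have /upper_density_gt0P[a a0 aB] := qD _ qtA.
have bR0 : 0 < b%:R :> R by rewrite ltr0n.
(* t F_i0 s' meets [A] in at least 2e |F_i0| points. Covering it by F_i s s' loses fewer than e
   |F_i0|, and what remains is at least (e/c) |F_i|. *)
pose e : R := a / b%:R / 2.
have e0 : 0 < e by rewrite !divr_gt0.
have [c [c0 [l lP]]] := star e e0 t.
have cR0 : 0 < c%:R :> R by rewrite ltr0n.
apply/upper_density_gt0P; exists (e / c%:R); first exact: divr_gt0.
(* Beyond [l] condition ( * ) applies to [i0]; beyond [j0] the final index [i] is admissible. *)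
move=> j0; have [k [j0k lk]] := Idir.2 j0 l.
have [i0 [ki0 [s' le]]] := aB k.
have [i [i0i [s [ltD leF]]]] := lP i0 (le_trans lk ki0).
exists i; split; first exact: le_trans j0k (le_trans ki0 i0i).
have [s'' s''E] := rtranslate_rtranslate (F i) s s'.
exists s''; rewrite -s''E.
set Y := rtranslate _ s'.
set X := rtranslate (ltranslate t (F i0)) s'.
have hA : (cardI (ldiv t A) (rtranslate (F i0) s') <= b * cardI A X)%N.
  rewrite /X -ltranslate_rtranslate.
  by apply: cardI_image => // u; exact: lc.
have hD := leq_trans (cardI_fsetD A X Y)
  (leq_add (leqnn _) (card_rtranslateD _ _ s')).
move: hA hD leF; rewrite -!(ler_nat R) natrD !natrM => hA hD leF.
have haX : 2 * e * #|` F i0|%:R <= (cardI A X)%:R.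
  rewrite -(ler_pM2l bR0) (le_trans _ hA) // (le_trans _ le) //.
  by rewrite /e !mulrA le_eqVlt; apply/orP; left; apply/eqP; field; lra.
have heF : e / c%:R * #|` F i|%:R <= e * #|` F i0|%:R.
  by rewrite mulrAC ler_pdivrMr // -[X in _ <= X]mulrA ler_pM2l // mulrC.
by move: ltD; lra.
Qed.

End PositiveDensity.

Theorem theorem2p5 (R : realType) (S : semigroupType)
    (d : Order.disp_t) (I : preorderType d) (F : I -> {fset S})
    (Idir : directed I) (Fne : forall i : I, F i <> fset0)
    (H : (exists b : nat, (0 < b)%N /\ weakly_right_cancellative S b) \/
         ((exists b : nat, (0 < b)%N /\ weakly_left_cancellative S b) /\
          condition_star R F)) :
  exists A : set S, D_set R F A.
Proof.
have DE q : UltraFilter q -> Dstar R F q <-> (conull R S d I F `<=` q)%classic.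
  exact: DstarE.
have [|p q pU qU /(DE _ pU) pD /(DE _ qU) qD|p [pU cp pp]] :=
    @closed_subsemigroup_idempotent _ (conull R S d I F).
- exact: conull_proper.
- apply/(DE _ (beta_mul_ultra pU qU)).
  (* [Dstar] absorbs right factors in the first case and left factors in the second. *)
  case: H => [[b [b0 rc]]|[[b [b0 lc]] star]].
    exact: Dstar_mulr rc qU pD.
  exact: Dstar_mull lc star pU qD.
(* S itself belongs to the idempotent found, so it is a D-set. *)
- by exists setT, p; split=> //; [exact/DE|exact: filterT].
Qed.
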